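(* Let $\Bbbk$ be a field and let $\mathcal T$ be a finite vacant double groupoid with set of boxes $\mathcal B$. Then the vector space $\Bbbk\mathcal T$ with basis $\mathcal B$, with the multiplication, unit, comultiplication and counit described in the context, is a quantum groupoid (weak Hopf algebra) with antipode the linear map determined by $\mathcal S(A)=A^{-1}$ for all $A\in\mathcal B$. Its source and target subalgebras are, respectively, $\Bbbk\mathcal T_s$ (the subalgebra generated by the elements $\mathbf 1_P$, $P\in\mathcal P$) and $\Bbbk\mathcal T_t$ (the subalgebra generated by the elements ${}_P\mathbf 1$, $P\in\mathcal P$).
   Context: Convention: in a category, $fg$ means ''first $f$, then $g$'' (defined when target of $f$ = source of $g$). Double categories. A (small) double category $\mathcal T$ consists of non-empty sets $\mathcal B$ (boxes), $\mathcal H$ (horizontal edges), $\mathcal V$ (vertical edges), $\mathcal P$ (points) and four categories: (arrows $\mathcal B$, objects $\mathcal H$, source $t$, target $b$), whose composition is called vertical; (arrows $\mathcal B$, objects $\mathcal V$, source $l$, target $r$), whose composition is called horizontal; (arrows $\mathcal H$, objects $\mathcal P$, source $l$, target $r$); (arrows $\mathcal V$, objects $\mathcal P$, source $t$, target $b$). ($t,b,l,r$ stand for top, bottom, left, right.) Write $A\circ_v B$ ($A$ on top of $B$) for the vertical composite, defined when $b(A)=t(B)$, and $AB$ for the horizontal composite, defined when $r(A)=l(B)$. Write $\mathrm{id}_P$ for the identities in $\mathcal H$ and in $\mathcal V$ at $P\in\mathcal P$; for $x\in\mathcal H$, $\mathbf{id}_x\in\mathcal B$ is the identity of $x$ for vertical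 composition (a ''vertical identity''); for $g\in\mathcal V$, $\mathbf{id}_g\in\mathcal B$ is the identity of $g$ for horizontal composition (a ''horizontal identity''). Axioms: (1) $tr=rt$, $tl=lt$, $bl=lb$, $br=rb$ as maps $\mathcal B\to\mathcal P$; (2) $t(AB)=t(A)t(B)$, $b(AB)=b(A)b(B)$, $l(A\circ_v B)=l(A)l(B)$, $r(A\circ_v B)=r(A)r(B)$; (3) interchange: $(AB)\circ_v(CD)=(A\circ_v C)(B\circ_v D)$ whenever $r(A)=l(B)$, $r(C)=l(D)$, $b(A)=t(C)$, $b(B)=t(D)$; (4) for $x\in\mathcal H$, $l(\mathbf{id}_x)=\mathrm{id}_{l(x)}$, $r(\mathbf{id}_x)=\mathrm{id}_{r(x)}$; for $g\in\mathcal V$, $t(\mathbf{id}_g)=\mathrm{id}_{t(g)}$, $b(\mathbf{id}_g)=\mathrm{id}_{b(g)}$; (5) for $P\in\mathcal P$ the vertical identity of the horizontal edge $\mathrm{id}_P$ equals the horizontal identity of the vertical edge $\mathrm{id}_P$; (6) $\mathbf{id}_g\circ_v\mathbf{id}_h=\mathbf{id}_{gh}$ for composable $g,h\in\mathcal V$ and $\mathbf{id}_x\mathbf{id}_y=\mathbf{id}_{xy}$ for composable $x,y\in\mathcal H$. A double groupoid is a double category all four of whose categories are groupoids. $A^h$, $A^v$ denote the inverses of a box $A$ for horizontal and vertical composition, and $A^{-1}:=(A^h)^v=(A^v)^h$. It is finite if $\mathcal B,\mathcal H,\mathcal V,\mathcal P$ are finite. It is vacant if for all $g\in\mathcal V$,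 $x\in\mathcal H$ with $r(x)=t(g)$ there is exactly one $X\in\mathcal B$ with $t(X)=x$, $r(X)=g$. Structure of $\Bbbk\mathcal T$: $\Bbbk\mathcal T$ has basis $\mathcal B$; for boxes $A,B$, $A.B=A\circ_v B$ if $b(A)=t(B)$ and $A.B=0$ otherwise; unit $\mathbf 1=\sum_{x\in\mathcal H}\mathbf{id}_x$; $\Delta(A)=\sum B\otimes C$ over all pairs of boxes with $r(B)=l(C)$ and $BC=A$; $\varepsilon(A)=1$ if $A=\mathbf{id}_{l(A)}$ is a horizontal identity and $\varepsilon(A)=0$ otherwise. For $P\in\mathcal P$, ${}_P\mathbf 1=\sum_{x\in\mathcal H,\,l(x)=P}\mathbf{id}_x$ and $\mathbf 1_P=\sum_{x\in\mathcal H,\,r(x)=P}\mathbf{id}_x$. Weak Hopf algebra (= quantum groupoid): an associative unital algebra and coassociative counital coalgebra $H$ with $\Delta(ab)=\Delta(a)\Delta(b)$; $\Delta^{(2)}(1)=(\Delta(1)\otimes1)(1\otimes\Delta(1))=(1\otimes\Delta(1))(\Delta(1)\otimes1)$; $\varepsilon(abc)=\varepsilon(ab_1)\varepsilon(b_2c)=\varepsilon(ab_2)\varepsilon(b_1c)$ (Sweedler notation); and a linear antipode $\mathcal S:H\to H$ with $m(\mathrm{id}\otimes\mathcal S)\Delta(h)=(\varepsilon\otimes\mathrm{id})(\Delta(1)(h\otimes1))=:\varepsilon_t(h)$, $m(\mathcal S\otimes\mathrm{id})\Delta(h)=(\mathrm{id}\otimes\varepsilon)((1\otimes h)\Delta(1))=:\varepsilon_s(h)$,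 $m^{(2)}(\mathcal S\otimes\mathrm{id}\otimes\mathcal S)\Delta^{(2)}=\mathcal S$. The source and target subalgebras are the images of $\varepsilon_s$ and $\varepsilon_t$ respectively. *)

(* Defs.v *)
From HB Require Import structures.
From mathcomp Require Import all_boot all_algebra.
Set Implicit Arguments.
Unset Strict Implicit.
Unset Printing Implicit Defensive.
Import GRing.Theory.
Local Open Scope ring_scope.

(* A category with set of objects [Ob] and set of arrows [Ar].  [ccomp C f g] is
   "first f, then g"; it is a total function, but only its values at composable
   pairs ([tgt C f = src C g]) are constrained and used. *)
Record category (Ob Ar : Type) := Category {
  src : Ar -> Ob;
  tgt : Ar -> Ob;
  idn : Ob -> Ar;
  ccomp : Ar -> Ar -> Ar;
  src_idn : forall x, src (idn x) = x;
  tgt_idn : forall x, tgt (idn x) = x;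
  src_comp : forall f g, tgt f = src g -> src (ccomp f g) = src f;
  tgt_comp : forall f g, tgt f = src g -> tgt (ccomp f g) = tgt g;
  comp_idl : forall f, ccomp (idn (src f)) f = f;
  comp_idr : forall f, ccomp f (idn (tgt f)) = f;
  ccompA : forall f g h, tgt f = src g -> tgt g = src h ->
    ccomp f (ccomp g h) = ccomp (ccomp f g) h
}.

(* The inverses of a groupoid are determined by the category, so keeping them
   as data is the same as asking that every arrow be invertible. *)
Record inverses (Ob Ar : Type) (C : category Ob Ar) := Inverses {
  inv :> Ar -> Ar;
  src_inv : forall f, src C (inv f) = tgt C f;
  tgt_inv : forall f, tgt C (inv f) = src C f;
  comp_invr : forall f, ccomp C f (inv f) = idn C (src C f);
  comp_invl : forall f, ccomp C (inv f) f = idn C (tgt C f)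
}.

(* [vcat]: boxes over horizontal edges (vertical composition);
   [hcat]: boxes over vertical edges (horizontal composition);
   [hedge], [vedge]: the categories of edges over points. *)
Record double_category (B H V P : Type) := DoubleCategory {
  vcat : category H B;
  hcat : category V B;
  hedge : category P H;
  vedge : category P V;

  boxes_nonempty : inhabited B;
  hedges_nonempty : inhabited H;
  vedges_nonempty : inhabited V;
  points_nonempty : inhabited P;

  corner_tr : forall A, tgt hedge (src vcat A) = src vedge (tgt hcat A);
  corner_tl : forall A, src hedge (src vcat A) = src vedge (src hcat A);
  corner_bl : forall A, src hedge (tgt vcat A) = tgt vedge (src hcat A);
  corner_br : forall A, tgt hedge (tgt vcat A) = tgt vedge (tgt hcat A);

  top_hcomp : forall X Y, tgt hcat X = src hcat Y ->
    src vcat (ccomp hcat X Y) = ccomp hedge (src vcat X) (src vcat Y);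
  bot_hcomp : forall X Y, tgt hcat X = src hcat Y ->
    tgt vcat (ccomp hcat X Y) = ccomp hedge (tgt vcat X) (tgt vcat Y);
  left_vcomp : forall X Y, tgt vcat X = src vcat Y ->
    src hcat (ccomp vcat X Y) = ccomp vedge (src hcat X) (src hcat Y);
  right_vcomp : forall X Y, tgt vcat X = src vcat Y ->
    tgt hcat (ccomp vcat X Y) = ccomp vedge (tgt hcat X) (tgt hcat Y);

  interchange : forall X Y Z W,
    tgt hcat X = src hcat Y -> tgt hcat Z = src hcat W ->
    tgt vcat X = src vcat Z -> tgt vcat Y = src vcat W ->
    ccomp vcat (ccomp hcat X Y) (ccomp hcat Z W)
    = ccomp hcat (ccomp vcat X Z) (ccomp vcat Y W);

  left_vid : forall x, src hcat (idn vcat x) = idn vedge (src hedge x);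
  right_vid : forall x, tgt hcat (idn vcat x) = idn vedge (tgt hedge x);
  top_hid : forall g, src vcat (idn hcat g) = idn hedge (src vedge g);
  bot_hid : forall g, tgt vcat (idn hcat g) = idn hedge (tgt vedge g);

  vid_hid_point : forall p, idn vcat (idn hedge p) = idn hcat (idn vedge p);

  vcomp_hid : forall g h, tgt vedge g = src vedge h ->
    ccomp vcat (idn hcat g) (idn hcat h) = idn hcat (ccomp vedge g h);
  hcomp_vid : forall x y, tgt hedge x = src hedge y ->
    ccomp hcat (idn vcat x) (idn vcat y) = idn vcat (ccomp hedge x y)
}.

Record double_groupoid (B H V P : Type) := DoubleGroupoid {
  dcat :> double_category B H V P;
  vinv : inverses (vcat dcat);
  hinv : inverses (hcat dcat);
  hedge_inv : inverses (hedge dcat);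
  vedge_inv : inverses (vedge dcat)
}.

Section DoubleCategoryNotions.
Variables (B H V P : Type) (T : double_category B H V P).

Definition btop : B -> H := src (vcat T).
Definition bbot : B -> H := tgt (vcat T).
Definition bleft : B -> V := src (hcat T).
Definition bright : B -> V := tgt (hcat T).
Definition vcomp : B -> B -> B := ccomp (vcat T).
Definition hcomp : B -> B -> B := ccomp (hcat T).
Definition vid : H -> B := idn (vcat T).
Definition hid : V -> B := idn (hcat T).

Definition vacant : Prop := forall (x : H) (g : V),
  tgt (hedge T) x = src (vedge T) g ->
  exists! X : B, btop X = x /\ bright X = g.

End DoubleCategoryNotions.

Definition box_inv (B H V P : Type) (T : double_groupoid B H V P) (A : B) : B :=
  vinv T (hinv T A).

Section FreeSpace.
Variable k : fieldType.

(* The vector space with basis the finite set [I].  The tensor product of the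
   spaces with bases [I] and [J] is the space with basis [I * J]. *)
Definition fspace (I : finType) := {ffun I -> k^o}.

Definition bvec (I : finType) (i : I) : fspace I := [ffun j => (j == i)%:R].

(* The linear map that sends the basis vector [i] to [f i]. *)
Definition linext (I : finType) (W : lmodType k) (f : I -> W) (u : fspace I) : W :=
  \sum_(i : I) u i *: f i.

Definition tens (I J : finType) (u : fspace I) (v : fspace J) : fspace (I * J)%type :=
  [ffun p => u p.1 * v p.2].

Definition tens3 (I : finType) (u v w : fspace I) : fspace (I * I * I)%type :=
  tens (tens u v) w.

(* The linear map on the tensor product induced by a map [f] that is linear in
   each variable. *)
Definition tlift (I : finType) (W : lmodType k) (f : fspace I -> fspace I -> W) :
    fspace (I * I)%type -> W :=
  linext (fun p => f (bvec p.1) (bvec p.2)).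

Definition tlift3 (I : finType) (W : lmodType k)
    (f : fspace I -> fspace I -> fspace I -> W) : fspace (I * I * I)%type -> W :=
  linext (fun p => f (bvec p.1.1) (bvec p.1.2) (bvec p.2)).

Lemma linext_bvec (I : finType) (W : lmodType k) (f : I -> W) (i : I) :
  linext f (bvec i) = f i.
Proof.
rewrite /linext (bigD1 i) //= big1 => [|j jNi]; rewrite ffunE.
  by rewrite eqxx scale1r addr0.
by rewrite (negbTE jNi) scale0r.
Qed.

Lemma bvec_sum (I : finType) (u : fspace I) : u = \sum_(i : I) u i *: bvec i.
Proof.
apply/ffunP => j; rewrite sum_ffunE (bigD1 j) //= big1 => [|i iNj].
  by rewrite addr0 !ffunE eqxx /GRing.scale /= mulr1.
by rewrite !ffunE eq_sym (negbTE iNj) /GRing.scale /= mulr0.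
Qed.

Lemma tlift_tens (I : finType) (W : lmodType k) (f : fspace I -> fspace I -> W) :
  (forall v, linear (fun u => f u v)) -> (forall u, linear (f u)) ->
  forall u v, tlift f (tens u v) = f u v.
Proof.
move=> fl fr u v.
pose fL w := GRing.isLinear.Build k (fspace I) W _ _ (fl w).
pose fR w := GRing.isLinear.Build k (fspace I) W _ _ (fr w).
pose gL w : {linear fspace I -> W} := HB.pack (fun u => f u w) (fL w).
pose gR w : {linear fspace I -> W} := HB.pack (f w) (fR w).
rewrite [RHS](_ : _ = gL v u) // [in RHS](bvec_sum u) linear_sum.
transitivity (\sum_i \sum_j tens u v (i, j) *: f (bvec i) (bvec j)).
  by rewrite pair_bigA; apply: eq_bigr => -[].
apply: eq_bigr => i _; rewrite linearZZ /=.
rewrite [X in _ *: X](_ : _ = gR (bvec i) v) // [in RHS](bvec_sum v) linear_sum.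
rewrite scaler_sumr; apply: eq_bigr => j _.
by rewrite linearZZ scalerA ffunE.
Qed.

End FreeSpace.

(* Sweedler notation: [\sw_(a, b <- t) E] is the sum of E over t = a (x) b. *)
Notation "\sw_ ( a , b <- t ) E" := (tlift (fun a b => E) t)
  (at level 36, a name, b name, t at level 200, E at level 36,
   format "\sw_ ( a ,  b  <-  t )  E").
Notation "\sw_ ( a , b , c <- t ) E" := (tlift3 (fun a b c => E) t)
  (at level 36, a name, b name, c name, t at level 200, E at level 36,
   format "\sw_ ( a ,  b ,  c  <-  t )  E").

Section WeakHopf.
Variables (k : fieldType) (I : finType).
Local Notation H := (fspace k I).
Local Notation H2 := (fspace k (I * I)%type).
Local Notation H3 := (fspace k (I * I * I)%type).

Record bialg_data := BialgData {
  hmul : H -> H -> H;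
  hone : H;
  Delta : H -> H2;
  eps : H -> k^o
}.

Variable D : bialg_data.
Local Notation "a ** b" := (hmul D a b) (at level 40, left associativity).

Definition mul2 (s t : H2) : H2 :=
  \sw_(a, b <- s) \sw_(c, d <- t) tens (a ** c) (b ** d).

Definition mul3 (s t : H3) : H3 :=
  \sw_(a, b, c <- s) \sw_(d, e, f <- t) tens3 (a ** d) (b ** e) (c ** f).

Definition Delta2 (h : H) : H3 :=
  \sw_(a, b <- Delta D h) \sw_(a1, a2 <- Delta D a) tens3 a1 a2 b.

Definition eps_t (h : H) : H :=
  \sw_(a, b <- mul2 (Delta D (hone D)) (tens h (hone D))) (eps D a *: b).

Definition eps_s (h : H) : H :=
  \sw_(a, b <- mul2 (tens (hone D) h) (Delta D (hone D))) (eps D b *: a).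

Record is_algebra : Prop := IsAlgebra {
  mul_linear_l : forall b, linear (fun a => a ** b);
  mul_linear_r : forall a, linear (fun b => a ** b);
  mul_assoc : forall a b c, a ** (b ** c) = (a ** b) ** c;
  mul_one_l : forall a, hone D ** a = a;
  mul_one_r : forall a, a ** hone D = a
}.

Record is_coalgebra : Prop := IsCoalgebra {
  Delta_linear : linear (Delta D);
  eps_linear : linear (eps D);
  Delta_coassoc : forall h,
    Delta2 h = \sw_(a, b <- Delta D h) \sw_(b1, b2 <- Delta D b) tens3 a b1 b2;
  counit_l : forall h, \sw_(a, b <- Delta D h) (eps D a *: b) = h;
  counit_r : forall h, \sw_(a, b <- Delta D h) (eps D b *: a) = h
}.

Record is_weak_bialgebra : Prop := IsWeakBialgebra {
  weak_algebra : is_algebra;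
  weak_coalgebra : is_coalgebra;
  Delta_mul : forall a b, Delta D (a ** b) = mul2 (Delta D a) (Delta D b);
  Delta2_one_l :
    Delta2 (hone D) = mul3 (\sw_(a, b <- Delta D (hone D)) tens3 a b (hone D))
                          (\sw_(a, b <- Delta D (hone D)) tens3 (hone D) a b);
  Delta2_one_r :
    Delta2 (hone D) = mul3 (\sw_(a, b <- Delta D (hone D)) tens3 (hone D) a b)
                          (\sw_(a, b <- Delta D (hone D)) tens3 a b (hone D));
  eps_mul_l : forall a b c, eps D (a ** b ** c)
    = \sw_(b1, b2 <- Delta D b) (eps D (a ** b1) * eps D (b2 ** c));
  eps_mul_r : forall a b c, eps D (a ** b ** c)
    = \sw_(b1, b2 <- Delta D b) (eps D (a ** b2) * eps D (b1 ** c))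
}.

Record is_antipode (S : H -> H) : Prop := IsAntipode {
  antipode_linear : linear S;
  antipode_t : forall h, \sw_(a, b <- Delta D h) (a ** S b) = eps_t h;
  antipode_s : forall h, \sw_(a, b <- Delta D h) (S a ** b) = eps_s h;
  antipode_id : forall h, \sw_(a, b, c <- Delta2 h) (S a ** b ** S c) = S h
}.

Definition is_weak_hopf_algebra (S : H -> H) : Prop :=
  is_weak_bialgebra /\ is_antipode S.

Definition in_source_subalgebra (x : H) : Prop := exists h, x = eps_s h.

Definition in_target_subalgebra (x : H) : Prop := exists h, x = eps_t h.

Record is_subalgebra (A : H -> Prop) : Prop := IsSubalgebra {
  sub_one : A (hone D);
  sub_add : forall x y, A x -> A y -> A (x + y);
  sub_scale : forall (c : k) x, A x -> A (c *: x);
  sub_mul : forall x y, A x -> A y -> A (x ** y)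
}.

Definition in_generated_subalgebra (X : H -> Prop) (x : H) : Prop :=
  forall A : H -> Prop, is_subalgebra A -> (forall y, X y -> A y) -> A x.

End WeakHopf.

Section BoxAlgebra.
Variables (k : fieldType) (B H V P : finType).
Local Notation kT := (fspace k B).

Section DoubleCategory.
Variable T : double_category B H V P.

Definition box_mul : kT -> kT -> kT := fun u v =>
  linext (fun X => linext (fun Y =>
    if bbot T X == btop T Y then bvec k (vcomp T X Y) else 0) v) u.

Definition box_one : kT := \sum_(x : H) bvec k (vid T x).

Definition box_Delta : kT -> fspace k (B * B)%type :=
  linext (fun A =>
    \sum_(p : B * B | (bright T p.1 == bleft T p.2) && (hcomp T p.1 p.2 == A))
      tens (bvec k p.1) (bvec k p.2)).

Definition box_eps : kT -> k^o :=
  linext (fun A => (A == hid T (bleft T A))%:R : k^o).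

Definition box_bialg : bialg_data k B :=
  BialgData box_mul box_one box_Delta box_eps.

(* The elements ${}_P\mathbf 1$ and $\mathbf 1_P$. *)
Definition lunit (p : P) : kT :=
  \sum_(x : H | src (hedge T) x == p) bvec k (vid T x).

Definition runit (p : P) : kT :=
  \sum_(x : H | tgt (hedge T) x == p) bvec k (vid T x).

End DoubleCategory.

Definition box_antipode (T : double_groupoid B H V P) : kT -> kT :=
  linext (fun A => bvec k (box_inv T A)).

End BoxAlgebra.

Arguments box_antipode k {B H V P} T.

(* Main.v *)
(** A box of a vacant double groupoid is determined by its top (or bottom) edge
together with its right (or left) edge, and each such adjacent pair of edges
bounds a box.  Multiplicativity of Delta then says that cutting a vertical
composite of X and Y by a vertical line amounts to cutting X and Y along lines
that match on their common edge: a cut of the composite gives the top edges of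
the two pieces of X, hence, going leftwards from the right edge of X, the
pieces themselves.  Vacancy also shows that a box whose top or bottom edge is an
identity is a horizontal identity, so that epsilon of a product vanishes unless
all factors are horizontal identities, and that a horizontal cut of a vertical
identity consists of vertical identities, so that Delta(1) is the sum of id_x
(x) id_y over composable x, y.  If BC = A, the product of B with the inverse of
C vanishes unless A is a horizontal identity id_g; in that case C is the
horizontal inverse of B, the product is the vertical identity of the top of B,
and B is determined by that edge, so the sum over the cuts of A is the element
_P 1 with P the top of g, which is also epsilon_t(A); similarly for epsilon_s.
The elements _P 1, as well as the 1_P, are orthogonal idempotents with sum 1,
hence span the subalgebra they generate. *)

Require Import Defs.
From HB Require Import structures.
From mathcomp Require Import all_boot all_algebra.
Set Implicit Arguments.
Unset Strict Implicit.
Unset Printing Implicit Defensive.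
Import GRing.Theory.
Local Open Scope ring_scope.

(** * Linear and multilinear maps on spaces with a finite basis *)

Section FreeSpaceTheory.
Variable k : fieldType.

Lemma linext_linear (I : finType) (W : lmodType k) (f : I -> W) :
  linear (linext f).
Proof.
move=> c u v; rewrite /linext scaler_sumr -big_split; apply: eq_bigr => i _ /=.
by rewrite !ffunE -[c *: u i]/(c * u i) scalerDl scalerA.
Qed.

HB.instance Definition _ (I : finType) (W : lmodType k) (f : I -> W) :=
  GRing.isLinear.Build k (fspace k I) W _ (linext f) (linext_linear f).

HB.instance Definition _ (I : finType) (W : lmodType k)
    (f : fspace k I -> fspace k I -> W) :=
  GRing.Linear.copy (tlift f) (tlift f).

HB.instance Definition _ (I : finType) (W : lmodType k)
    (f : fspace k I -> fspace k I -> fspace k I -> W) :=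
  GRing.Linear.copy (tlift3 f) (tlift3 f).

Lemma linear_expand (I : finType) (W : lmodType k) (f : fspace k I -> W) :
  linear f -> f =1 linext (fun i => f (bvec k i)).
Proof.
move=> fl u; pose fL := GRing.isLinear.Build k (fspace k I) W _ _ fl.
pose f' : {linear fspace k I -> W} := HB.pack f fL.
rewrite [LHS](_ : _ = f' u) // [in LHS](bvec_sum u) linear_sum.
by apply: eq_bigr => i _; rewrite linearZZ.
Qed.

(** Identities between multilinear maps are reduced by this to identities between boxes, one
    argument at a time. *)
Lemma linear_bvec_ext (I : finType) (W : lmodType k) (f g : fspace k I -> W) :
  linear f -> linear g -> (forall i, f (bvec k i) = g (bvec k i)) -> f =1 g.
Proof.
move=> fl gl fg u; rewrite linear_expand // [RHS]linear_expand //.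
by apply: eq_bigr => i _; rewrite fg.
Qed.

Lemma tens_bvec (I J : finType) (i : I) (j : J) :
  tens (bvec k i) (bvec k j) = bvec k (i, j).
Proof. by apply/ffunP => -[a b]; rewrite !ffunE xpair_eqE -natrM mulnb. Qed.

Lemma tens_linear_l (I J : finType) (v : fspace k J) :
  linear (fun u : fspace k I => tens u v).
Proof.
by move=> c u w; apply/ffunP => p; rewrite !ffunE /GRing.scale /= mulrDl mulrA.
Qed.

Lemma tens_linear_r (I J : finType) (u : fspace k I) :
  linear (fun v : fspace k J => tens u v).
Proof.
move=> c v w; apply/ffunP => p; rewrite !ffunE /GRing.scale /= mulrDr.
by rewrite mulrCA.
Qed.

HB.instance Definition _ (I J : finType) (u : fspace k I) :=
  GRing.isLinear.Build k (fspace k J) (fspace k (I * J)%type) _ (tens u)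
    (tens_linear_r u).

Lemma tens0l (I J : finType) (v : fspace k J) : tens (0 : fspace k I) v = 0.
Proof. by apply/ffunP => p; rewrite !ffunE mul0r. Qed.

Lemma tlift3_tens (I : finType) (W : lmodType k)
    (f : fspace k I -> fspace k I -> fspace k I -> W) :
  (forall v w, linear (fun u => f u v w)) ->
  (forall u w, linear (fun v => f u v w)) -> (forall u v, linear (f u v)) ->
  forall u v w, tlift3 f (tens3 u v w) = f u v w.
Proof.
move=> f1 f2 f3 u v w; move: u.
apply: linear_bvec_ext => // [c u u'|i].
  by rewrite /tens3 !tens_linear_l linearP.
move: v; apply: linear_bvec_ext => // [c v v'|j].
  by rewrite /tens3 linearP /= tens_linear_l linearP.
move: w; apply: linear_bvec_ext => // [c w w'|l].
  by rewrite /tens3 linearP /= linearP.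
by rewrite /tens3 !tens_bvec /tlift3 linext_bvec.
Qed.

Lemma tlift_bvec (I : finType) (W : lmodType k)
    (f : fspace k I -> fspace k I -> W) p :
  tlift f (bvec k p) = f (bvec k p.1) (bvec k p.2).
Proof. exact: linext_bvec. Qed.

Lemma tlift_sum (I J : finType) (W : lmodType k)
    (f : fspace k I -> fspace k I -> W) (Q : pred J) s :
  tlift f (\sum_(j | Q j) s j) = \sum_(j | Q j) tlift f (s j).
Proof. exact: linear_sum. Qed.

Lemma linear_linext (I : finType) (W W' : lmodType k) (f : I -> W' -> W)
    (u : fspace k I) :
  (forall i, linear (f i)) -> linear (fun x => linext (fun i => f i x) u).
Proof.
move=> fl c x y; rewrite /linext scaler_sumr -big_split.
by apply: eq_bigr => i _ /=; rewrite fl scalerDr !scalerA mulrC.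
Qed.

(** [tlift] evaluates [f] at basis vectors only, so linearity in the parameter is asked only
    there. *)
Lemma linear_tlift (I : finType) (W W' : lmodType k)
    (f : fspace k I -> fspace k I -> W' -> W) (s : fspace k (I * I)%type) :
  (forall i j, linear (f (bvec k i) (bvec k j))) ->
  linear (fun x => tlift (fun a b => f a b x) s).
Proof. by move=> fl; apply: linear_linext => p; exact: fl. Qed.

Lemma linear_tlift3 (I : finType) (W W' : lmodType k)
    (f : fspace k I -> fspace k I -> fspace k I -> W' -> W)
    (s : fspace k (I * I * I)%type) :
  (forall i j l, linear (f (bvec k i) (bvec k j) (bvec k l))) ->
  linear (fun x => tlift3 (fun a b c => f a b c x) s).
Proof. by move=> fl; apply: linear_linext => p; exact: fl. Qed.

End FreeSpaceTheory.

(** * Componentwise products on tensor squares and cubes *)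

Section AlgebraTheory.
Variables (k : fieldType) (I : finType) (D : bialg_data k I).
Local Notation "a ** b" := (hmul D a b) (at level 40, left associativity).

Lemma mul2_linear_r s : linear (mul2 D s).
Proof. by apply: linear_tlift => i j; exact: linearP. Qed.

HB.instance Definition _ s :=
  GRing.isLinear.Build k _ _ _ (mul2 D s) (mul2_linear_r s).

Lemma mul2_suml (J : finType) (Q : pred J) (f : J -> fspace k (I * I)%type) t :
  mul2 D (\sum_(j | Q j) f j) t = \sum_(j | Q j) mul2 D (f j) t.
Proof. exact: linear_sum. Qed.

Hypothesis algD : is_algebra D.

(** [mul2] applies [hmul] to basis vectors only; bilinearity of the product extends the formula to
    arbitrary pure tensors. *)
Lemma mul2_tens (a b c d : fspace k I) :
  mul2 D (tens a b) (tens c d) = tens (a ** c) (b ** d).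
Proof.
have ml := mul_linear_l algD; have mr := mul_linear_r algD.
rewrite /mul2 tlift_tens => [|v|u]; last 2 first.
- move=> l x y.
  apply: (linear_tlift (f := fun a b x => tens (x ** a) (v ** b))).
  by move=> i j e u w; rewrite ml tens_linear_l.
- move=> l x y.
  apply: (linear_tlift (f := fun a b x => tens (u ** a) (x ** b))).
  by move=> i j e v w; rewrite ml linearP.
rewrite tlift_tens // => [v|u] e x y; first by rewrite mr tens_linear_l.
by rewrite mr linearP.
Qed.

Lemma mul2_sumr (J : finType) (Q : pred J) s (f : J -> fspace k (I * I)%type) :
  mul2 D s (\sum_(j | Q j) f j) = \sum_(j | Q j) mul2 D s (f j).
Proof. exact: linear_sum. Qed.

Lemma mul3_linear_r s : linear (mul3 D s).
Proof. by apply: linear_tlift3 => i j l; exact: linearP. Qed.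

HB.instance Definition _ s :=
  GRing.isLinear.Build k _ _ _ (mul3 D s) (mul3_linear_r s).

Lemma mul3_suml (J : finType) (Q : pred J)
    (f : J -> fspace k (I * I * I)%type) t :
  mul3 D (\sum_(j | Q j) f j) t = \sum_(j | Q j) mul3 D (f j) t.
Proof. exact: linear_sum. Qed.

Lemma mul3_tens (a b c a' b' c' : fspace k I) :
  mul3 D (tens3 a b c) (tens3 a' b' c') = tens3 (a ** a') (b ** b') (c ** c').
Proof.
have ml := mul_linear_l algD; have mr := mul_linear_r algD.
rewrite /mul3 tlift3_tens; first rewrite tlift3_tens //.
- by move=> v w e x y; rewrite mr /tens3 !tens_linear_l.
- by move=> v w e x y; rewrite mr /tens3 linearP /= tens_linear_l.
- by move=> v w e x y; rewrite mr /tens3 linearP.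
- move=> v w l x y.
  apply: (linear_tlift3 (f := fun a b c x => tens3 (x ** a) (v ** b) (w ** c))).
  by move=> i j m e p q; rewrite ml /tens3 !tens_linear_l.
- move=> v w l x y.
  apply: (linear_tlift3 (f := fun a b c x => tens3 (v ** a) (x ** b) (w ** c))).
  by move=> i j m e p q; rewrite ml /tens3 linearP /= tens_linear_l.
- move=> v w l x y.
  apply: (linear_tlift3 (f := fun a b c x => tens3 (v ** a) (w ** b) (x ** c))).
  by move=> i j m e p q; rewrite ml /tens3 linearP.
Qed.

End AlgebraTheory.

(** * Cancellation in groupoids *)

Section Groupoid.
Variables (Ob Ar : Type) (C : category Ob Ar) (J : inverses C).
Local Notation s := (src C).
Local Notation t := (tgt C).
Local Notation "f ;; g" := (ccomp C f g) (at level 40, left associativity).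

Lemma ccompVK f g : t f = s g -> J f ;; (f ;; g) = g.
Proof.
by move=> fg; rewrite ccompA ?tgt_inv // comp_invl fg comp_idl.
Qed.

Lemma ccompKr f g : s f = s g -> f ;; (J f ;; g) = g.
Proof.
by move=> fg; rewrite ccompA ?tgt_inv ?src_inv // comp_invr fg comp_idl.
Qed.

Lemma ccomp_lcancel f g h :
  t f = s g -> t f = s h -> f ;; g = f ;; h -> g = h.
Proof. by move=> fg fh e; rewrite -(ccompVK fg) e ccompVK. Qed.

Lemma cinvK : involutive J.
Proof.
move=> f; apply: (@ccomp_lcancel (J f)); rewrite ?src_inv ?tgt_inv //.
by rewrite comp_invr src_inv comp_invl.
Qed.

End Groupoid.

(** * Boxes of a vacant double groupoid and their adjacent edges *)

Section VacantDoubleGroupoid.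
Variables (B H V P : Type) (T : double_groupoid B H V P).
Hypothesis vacT : vacant T.
Local Notation top := (src (vcat T)).
Local Notation bot := (tgt (vcat T)).
Local Notation left := (src (hcat T)).
Local Notation right := (tgt (hcat T)).
Local Notation hcomp := (ccomp (hcat T)).
Local Notation vcomp := (ccomp (vcat T)).
Local Notation hid := (idn (hcat T)).
Local Notation vid := (idn (vcat T)).

(** This is the uniqueness half of vacancy; the corner axiom at the top right supplies the
    adjacency. *)
Lemma box_tr_inj X Y : top X = top Y -> right X = right Y -> X = Y.
Proof.
move=> tXY rXY; have [Z [_ uniqZ]] := vacT (corner_tr T X).
by rewrite -(uniqZ X (conj erefl erefl)) -(uniqZ Y) // tXY rXY.
Qed.

(** The tops of [X] and of its horizontal inverse compose to an identity edge, and inverses of edges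
    are unique. The next three lemmas repeat this for bottoms and for vertical inverses. *)
Lemma top_hinv X : top (hinv T X) = hedge_inv T (top X).
Proof.
have e : right X = left (hinv T X) by rewrite src_inv.
apply: (@ccomp_lcancel _ _ _ (hedge_inv T) (top X)).
- by rewrite corner_tr corner_tl e.
- by rewrite src_inv.
- by rewrite -top_hcomp // !comp_invr top_hid corner_tl.
Qed.

Lemma bot_hinv X : bot (hinv T X) = hedge_inv T (bot X).
Proof.
have e : right X = left (hinv T X) by rewrite src_inv.
apply: (@ccomp_lcancel _ _ _ (hedge_inv T) (bot X)).
- by rewrite corner_br corner_bl e.
- by rewrite src_inv.
- by rewrite -bot_hcomp // !comp_invr bot_hid corner_bl.
Qed.

Lemma right_vinv X : right (vinv T X) = vedge_inv T (right X).
Proof.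
have e : bot X = top (vinv T X) by rewrite src_inv.
apply: (@ccomp_lcancel _ _ _ (vedge_inv T) (right X)).
- by rewrite -corner_tr -corner_br e.
- by rewrite src_inv.
- by rewrite -right_vcomp // !comp_invr right_vid corner_tr.
Qed.

Lemma left_vinv X : left (vinv T X) = vedge_inv T (left X).
Proof.
have e : bot X = top (vinv T X) by rewrite src_inv.
apply: (@ccomp_lcancel _ _ _ (vedge_inv T) (left X)).
- by rewrite -corner_tl -corner_bl e.
- by rewrite src_inv.
- by rewrite -left_vcomp // !comp_invr left_vid corner_tl.
Qed.

(** Vacancy speaks of the top right corner; horizontal inversion carries it to the top left one and,
    in the next lemma, vertical inversion carries it to the bottom right one. *)
Lemma box_tl_inj X Y : top X = top Y -> left X = left Y -> X = Y.
Proof.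
move=> tXY lXY; apply: (can_inj (cinvK (hinv T))).
by apply: box_tr_inj; rewrite ?top_hinv ?tgt_inv ?tXY.
Qed.

Lemma box_br_inj X Y : bot X = bot Y -> right X = right Y -> X = Y.
Proof.
move=> bXY rXY; apply: (can_inj (cinvK (vinv T))).
by apply: box_tr_inj; rewrite ?right_vinv ?src_inv ?rXY.
Qed.

Lemma box_tr_ex x g : tgt (hedge T) x = src (vedge T) g ->
  exists X, top X = x /\ right X = g.
Proof. by move=> /vacT[X [Xxg _]]; exists X. Qed.

Lemma box_tl_ex x g : src (hedge T) x = src (vedge T) g ->
  exists X, top X = x /\ left X = g.
Proof.
move=> xg; case: (@box_tr_ex (hedge_inv T x) g); first by rewrite tgt_inv.
by move=> X [tX rX]; exists (hinv T X); rewrite top_hinv tX cinvK src_inv.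
Qed.

Lemma box_br_ex x g : tgt (hedge T) x = tgt (vedge T) g ->
  exists X, bot X = x /\ right X = g.
Proof.
move=> xg; case: (@box_tr_ex x (vedge_inv T g)); first by rewrite src_inv.
by move=> X [tX rX]; exists (vinv T X); rewrite right_vinv rX cinvK tgt_inv.
Qed.

(** The two boxes share their right edge, and also their top, since [p] must be the top right corner
    of [X]. *)
Lemma top_idn_hid p X : top X = idn (hedge T) p -> X = hid (right X).
Proof.
move=> tX; apply: box_tr_inj; last by rewrite tgt_idn.
by rewrite top_hid -corner_tr tX tgt_idn.
Qed.

Lemma bot_idn_hid p X : bot X = idn (hedge T) p -> X = hid (right X).
Proof.
move=> bX; apply: box_br_inj; last by rewrite tgt_idn.
by rewrite bot_hid -corner_br bX tgt_idn.
Qed.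

Lemma right_idn_vid p X : right X = idn (vedge T) p -> X = vid (top X).
Proof.
move=> rX; apply: box_tr_inj; first by rewrite src_idn.
by rewrite right_vid corner_tr rX src_idn.
Qed.

End VacantDoubleGroupoid.

(** * The algebra of boxes under vertical composition *)

Section BoxBialgebra.
Variables (k : fieldType) (B H V P : finType) (T : double_category B H V P).
Local Notation kT := (fspace k B).
Local Notation top := (src (vcat T)).
Local Notation bot := (tgt (vcat T)).
Local Notation left := (src (hcat T)).
Local Notation right := (tgt (hcat T)).
Local Notation hcomp := (ccomp (hcat T)).
Local Notation vcomp := (ccomp (vcat T)).
Local Notation hid := (idn (hcat T)).
Local Notation vid := (idn (vcat T)).
Local Notation e := (bvec k).

Lemma box_mul_linear_l v : linear (fun u => box_mul T u v : kT).
Proof. exact: linearP. Qed.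

Lemma box_mul_linear_r u : linear (box_mul T u : kT -> kT).
Proof.
by apply: linear_linext => X; exact: linearP.
Qed.

HB.instance Definition _ (u : kT) :=
  GRing.isLinear.Build k kT kT _ (box_mul T u) (box_mul_linear_r u).

HB.instance Definition _ :=
  GRing.Linear.copy (@box_Delta k _ _ _ _ T) (@box_Delta k _ _ _ _ T).

HB.instance Definition _ :=
  GRing.Linear.copy (@box_eps k _ _ _ _ T) (@box_eps k _ _ _ _ T).

Lemma box_mul_suml (J : finType) (Q : pred J) (f : J -> kT) v :
  box_mul T (\sum_(j | Q j) f j) v = \sum_(j | Q j) box_mul T (f j) v.
Proof. exact: linear_sum. Qed.

Lemma box_mul_bvec X Y : box_mul T (e X) (e Y) =
  if bot X == top Y then e (vcomp X Y) else 0.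
Proof. by rewrite /box_mul !linext_bvec. Qed.

Lemma box_mul0l v : box_mul T 0 v = 0 :> kT.
Proof. exact: linear0. Qed.

Lemma box_algebra : is_algebra (box_bialg k T).
Proof.
split=> /=; [exact: box_mul_linear_l | exact: box_mul_linear_r | | |].
- move=> a b c; move: a; apply: linear_bvec_ext.
  + exact: box_mul_linear_l.
  + by move=> d u v; rewrite !box_mul_linear_l.
  move=> X; move: b; apply: linear_bvec_ext.
  + by move=> d u v; rewrite box_mul_linear_l linearP.
  + by move=> d u v; rewrite linearP /= box_mul_linear_l.
  move=> Y; move: c; apply: linear_bvec_ext => [d u v|d u v|Z].
  + by rewrite linearP /= linearP.
  + by rewrite linearP.
  (* Each bracketing vanishes unless all three boxes stack, because a composite keeps the top of its
     upper factor and the bottom of its lower one. *)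
  rewrite !box_mul_bvec; case: eqP => YZ; case: eqP => XY.
  + by rewrite !box_mul_bvec src_comp // tgt_comp // XY YZ !eqxx ccompA.
  + rewrite box_mul0l box_mul_bvec src_comp //.
    by case: eqP => // /XY.
  + rewrite linear0 box_mul_bvec tgt_comp //.
    by case: eqP => // /YZ.
  + by rewrite box_mul0l linear0.
- apply: linear_bvec_ext => [|//|X]; first exact: box_mul_linear_r.
  rewrite /box_one box_mul_suml.
  under eq_bigr => x _ do rewrite box_mul_bvec tgt_idn.
  by rewrite -big_mkcond big_pred1_eq comp_idl.
- apply: linear_bvec_ext => [|//|X]; first exact: box_mul_linear_l.
  rewrite /box_one linear_sum.
  under eq_bigr => x _ do rewrite /= box_mul_bvec src_idn eq_sym.
  by rewrite -big_mkcond big_pred1_eq comp_idr.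
Qed.

(** * Horizontal cuts and the coalgebra of boxes *)

Definition hdecomp (X : B) : pred (B * B) :=
  fun p => (right p.1 == left p.2) && (hcomp p.1 p.2 == X).

Lemma hdecompP X p :
  reflect (right p.1 = left p.2 /\ hcomp p.1 p.2 = X) (hdecomp X p).
Proof. by apply: (iffP andP) => -[/eqP ? /eqP]. Qed.

Lemma box_Delta_bvec X : box_Delta T (e X) = \sum_(p | hdecomp X p) e p.
Proof.
rewrite /box_Delta linext_bvec; apply: eq_bigr => -[Y Z] _.
exact: tens_bvec.
Qed.

Lemma tlift_Delta (W : lmodType k) (f : kT -> kT -> W) X :
  tlift f (box_Delta T (e X)) = \sum_(p | hdecomp X p) f (e p.1) (e p.2).
Proof.
by rewrite box_Delta_bvec tlift_sum; apply: eq_bigr => p _; rewrite tlift_bvec.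
Qed.

Definition horizontal_id (X : B) : bool := X == hid (left X).

Lemma horizontal_idP X : reflect (exists g, X = hid g) (horizontal_id X).
Proof.
apply: (iffP eqP) => [->|[g ->]]; first by eexists.
by rewrite src_idn.
Qed.

Lemma box_eps_bvec X : box_eps T (e X) = (horizontal_id X)%:R.
Proof. exact: linext_bvec. Qed.

(** Both sides run over the ways to cut [X] into three boxes in a row; [h] and [h'] translate
    between the two bracketings. *)
Lemma sum_hdecompA (W : nmodType) (f : B -> B -> B -> W) X :
  \sum_(p | hdecomp X p) \sum_(q | hdecomp p.1 q) f q.1 q.2 p.2 =
  \sum_(p | hdecomp X p) \sum_(q | hdecomp p.2 q) f p.1 q.1 q.2.
Proof.
rewrite !pair_big_dep /=.
pose h (u : (B * B) * (B * B)) := ((hcomp u.1.1 u.2.1, u.2.2), (u.1.1, u.2.1)).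
pose h' (u : (B * B) * (B * B)) := ((u.2.1, hcomp u.2.2 u.1.2), (u.2.2, u.1.2)).
rewrite (reindex_onto h h') => [|[[p1 p2] [q1 q2]]] /=; last first.
  by case/andP => _ /hdecompP[/= _ <-].
apply: eq_bigl => -[[p1 p2] [q1 q2]] /=.
apply/idP/idP => [/andP[/andP[/hdecompP[/= r1 c1] /hdecompP[/= r2 _]]]|].
  rewrite /h' /= => /eqP[<-].
  rewrite tgt_comp // in r1; apply/andP; split; apply/hdecompP => //=.
  by rewrite src_comp // ccompA.
case/andP=> /hdecompP[/= r1 c1] /hdecompP[/= r2 c2].
have r3 : right p1 = left q1 by rewrite r1 -c2 src_comp.
rewrite /h' /= c2 eqxx andbT; apply/andP; split; apply/hdecompP => //=.
by rewrite tgt_comp // -ccompA // c2.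
Qed.

(** A horizontal identity that is the left piece of [X] can only be the one on [left X], so a single
    cut survives. *)
Lemma sum_hdecomp_idl (W : nmodType) (f : B * B -> W) X :
  \sum_(p | hdecomp X p && horizontal_id p.1) f p = f (hid (left X), X).
Proof.
apply: big_pred1 => -[Y Z]; rewrite /= xpair_eqE.
apply/idP/idP => [/andP[/hdecompP[/= YZ <-] /horizontal_idP[g Yg]]|].
  by move: YZ; rewrite Yg tgt_idn => ->; rewrite comp_idl !eqxx.
case/andP=> /eqP-> /eqP->; apply/andP.
split; last by apply/horizontal_idP; eexists.
by apply/hdecompP; rewrite /= tgt_idn comp_idl.
Qed.

Lemma sum_hdecomp_idr (W : nmodType) (f : B * B -> W) X :
  \sum_(p | hdecomp X p && horizontal_id p.2) f p = f (X, hid (right X)).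
Proof.
apply: big_pred1 => -[Y Z]; rewrite /= xpair_eqE.
apply/idP/idP => [/andP[/hdecompP[/= YZ <-] /horizontal_idP[g Yg]]|].
  by move: YZ; rewrite Yg src_idn => <-; rewrite comp_idr !eqxx.
case/andP=> /eqP-> /eqP->; apply/andP.
split; last by apply/horizontal_idP; eexists.
by apply/hdecompP; rewrite /= src_idn comp_idr.
Qed.

Lemma box_Delta2_bvec X : Delta2 (box_bialg k T) (e X) =
  \sum_(p | hdecomp X p) \sum_(q | hdecomp p.1 q) e (q.1, q.2, p.2).
Proof.
rewrite /Delta2 /= tlift_Delta; apply: eq_bigr => p _.
by rewrite tlift_Delta; apply: eq_bigr => q _; rewrite /tens3 !tens_bvec.
Qed.

Lemma Delta2_linear : linear (Delta2 (box_bialg k T)).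
Proof. by move=> c u v; rewrite /Delta2 /= !linearP. Qed.

Lemma natr_scale (b : bool) (W : lmodType k) (w : W) :
  (b%:R : k) *: w = if b then w else 0.
Proof. by case: b; rewrite ?scale1r ?scale0r. Qed.

Lemma box_coalgebra : is_coalgebra (box_bialg k T).
Proof.
split=> /=; [exact: linearP | exact: linearP | | |].
- apply: linear_bvec_ext => [|c u v|X]; first exact: Delta2_linear.
    by rewrite !linearP.
  rewrite box_Delta2_bvec (sum_hdecompA (fun x y z => e (x, y, z))).
  rewrite tlift_Delta; apply: eq_bigr => p _.
  by rewrite tlift_Delta; apply: eq_bigr => q _; rewrite /tens3 !tens_bvec.
- apply: linear_bvec_ext => [c u v|//|X]; first by rewrite !linearP.
  rewrite tlift_Delta; under eq_bigr => p _ do rewrite box_eps_bvec natr_scale.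
  by rewrite -big_mkcondr sum_hdecomp_idl.
- apply: linear_bvec_ext => [c u v|//|X]; first by rewrite !linearP.
  rewrite tlift_Delta; under eq_bigr => p _ do rewrite box_eps_bvec natr_scale.
  by rewrite -big_mkcondr sum_hdecomp_idr.
Qed.

End BoxBialgebra.

(** Surjectivity is an existence statement here, with no inverse function to name; this is the form
    in which vacancy provides boxes. *)
Lemma sum_bij (W : nmodType) (I J : finType) (Q : pred I) (R : pred J)
    (f : J -> I) (F : I -> W) :
  (forall j, R j -> Q (f j)) -> {in R &, injective f} ->
  (forall i, Q i -> exists2 j, R j & f j = i) ->
  \sum_(i | Q i) F i = \sum_(j | R j) F (f j).
Proof.
move=> fQ f_inj f_surj; rewrite -(big_imset F f_inj).
apply: eq_bigl => i; apply/idP/imsetP => [/f_surj[j Rj <-]|[j Rj ->]].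
  by exists j.
exact: fQ.
Qed.

Section BoxWeakHopf.
Variables (k : fieldType) (B H V P : finType) (T : double_groupoid B H V P).
Hypothesis vacT : vacant T.
Local Notation kT := (fspace k B).
Local Notation top := (src (vcat T)).
Local Notation bot := (tgt (vcat T)).
Local Notation left := (src (hcat T)).
Local Notation right := (tgt (hcat T)).
Local Notation hcomp := (ccomp (hcat T)).
Local Notation vcomp := (ccomp (vcat T)).
Local Notation hid := (idn (hcat T)).
Local Notation vid := (idn (vcat T)).
Local Notation e := (bvec k).
Local Notation hle := (src (hedge T)).
Local Notation hri := (tgt (hedge T)).
Local Notation vto := (src (vedge T)).
Local Notation vbo := (tgt (vedge T)).
Local Notation horizontal_id := (horizontal_id T).
Local Notation hdecomp := (hdecomp T).

(** * The counit on products of boxes *)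

Lemma top_horizontal_id p X : top X = idn (hedge T) p -> horizontal_id X.
Proof.
by move/(top_idn_hid vacT) => XE; apply/horizontal_idP; exists (right X).
Qed.

Lemma bot_horizontal_id p X : bot X = idn (hedge T) p -> horizontal_id X.
Proof.
by move/(bot_idn_hid vacT) => XE; apply/horizontal_idP; exists (right X).
Qed.

(** If the composite is a horizontal identity, its top edge, shared with [X], and its bottom edge,
    shared with [Y], are identities; vacancy does the rest. *)
Lemma horizontal_id_vcomp X Y : bot X = top Y ->
  horizontal_id (vcomp X Y) = horizontal_id X && horizontal_id Y.
Proof.
move=> XY; apply/idP/andP => [/horizontal_idP[g XYg]|].
  split; [apply: (@top_horizontal_id (vto g))|
          apply: (@bot_horizontal_id (vbo g))].
    by rewrite -(src_comp XY) XYg top_hid.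
  by rewrite -(tgt_comp XY) XYg bot_hid.
case=> /horizontal_idP[g Xg] /horizontal_idP[h Yh]; apply/horizontal_idP.
exists (ccomp (vedge T) g h); rewrite Xg Yh vcomp_hid //.
(* Composability of [g] and [h] is read off from the endpoints of two equal identity edges. *)
move: XY; rewrite Xg Yh bot_hid top_hid => /(congr1 hle).
by rewrite !src_idn.
Qed.

Lemma box_eps_mul_bvec X Y : box_eps T (box_mul T (e X) (e Y)) =
  ((bot X == top Y) && (horizontal_id X && horizontal_id Y))%:R.
Proof.
rewrite box_mul_bvec; case: eqP => XY; last by rewrite linear0.
by rewrite box_eps_bvec horizontal_id_vcomp.
Qed.

Lemma box_eps_mul3_bvec X Y Z :
  box_eps T (box_mul T (box_mul T (e X) (e Y)) (e Z)) =
  [&& bot X == top Y, bot Y == top Z, horizontal_id X, horizontal_id Y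
    & horizontal_id Z]%:R.
Proof.
rewrite box_mul_bvec; case: eqP => XY /=; last by rewrite box_mul0l linear0.
rewrite box_eps_mul_bvec tgt_comp // horizontal_id_vcomp //.
by rewrite !andbA.
Qed.

Lemma hid_left X : horizontal_id X -> hid (left X) = X.
Proof. by move/eqP <-. Qed.

Lemma trilinear_ext (f g : kT -> kT -> kT -> k^o) :
  (forall v w, linear (fun u => f u v w)) ->
  (forall u w, linear (fun v => f u v w)) -> (forall u v, linear (f u v)) ->
  (forall v w, linear (fun u => g u v w)) ->
  (forall u w, linear (fun v => g u v w)) -> (forall u v, linear (g u v)) ->
  (forall X Y Z, f (e X) (e Y) (e Z) = g (e X) (e Y) (e Z)) ->
  forall u v w, f u v w = g u v w.
Proof.
move=> f1 f2 f3 g1 g2 g3 fg u v w; move: u; apply: linear_bvec_ext => // X.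
move: v; apply: linear_bvec_ext => // Y.
by move: w; apply: linear_bvec_ext.
Qed.

Lemma box_eps_mul_l u v w : box_eps T (box_mul T (box_mul T u v) w) =
  \sw_(v1, v2 <- box_Delta T v)
    (box_eps T (box_mul T u v1) * box_eps T (box_mul T v2 w)) :> k^o.
Proof.
move: u v w; apply: trilinear_ext.
- by move=> v w c x y; rewrite !(box_mul_linear_l, linearP).
- by move=> u w c x y; rewrite linearP /= box_mul_linear_l linearP.
- by move=> u v c x y; rewrite !linearP.
- move=> v w; apply: (linear_tlift (f := fun a b u =>
    box_eps T (box_mul T u a) * box_eps T (box_mul T b w))) => X Y c x y.
  by rewrite box_mul_linear_l linearP /GRing.scale /= mulrDl mulrA.
- by move=> u w c x y; rewrite !linearP.
- move=> u v; apply: (linear_tlift (f := fun a b w =>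
    box_eps T (box_mul T u a) * box_eps T (box_mul T b w))) => X Y c x y.
  by rewrite linearP linearP /GRing.scale /= mulrDr mulrCA.
(* This brings forward the test that the left piece of the cut is a horizontal identity, which
   leaves only the cut [(hid (left Y), Y)]. *)
have assoc a b c d x y : (a && (b && c)) && (d && (x && y)) =
  c && [&& a, d, b, x & y].
  by case: a; case: b; case: c; case: d; case: x.
move=> X Y Z; rewrite box_eps_mul3_bvec tlift_Delta.
under eq_bigr => p _.
  rewrite !box_eps_mul_bvec -natrM mulnb.
  rewrite assoc -mulnb natrM -[_ * _]/(_ *: _) natr_scale.
  over.
rewrite -big_mkcondr sum_hdecomp_idl /=.
(* If [Y] is a horizontal identity, both pieces equal [Y]; otherwise both sides vanish. *)
by case: (boolP (horizontal_id Y)) => [/hid_left->|_] //; rewrite !andbF.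
Qed.

Lemma box_eps_mul_r u v w : box_eps T (box_mul T (box_mul T u v) w) =
  \sw_(v1, v2 <- box_Delta T v)
    (box_eps T (box_mul T u v2) * box_eps T (box_mul T v1 w)) :> k^o.
Proof.
move: u v w; apply: trilinear_ext.
- by move=> v w c x y; rewrite !(box_mul_linear_l, linearP).
- by move=> u w c x y; rewrite linearP /= box_mul_linear_l linearP.
- by move=> u v c x y; rewrite !linearP.
- move=> v w; apply: (linear_tlift (f := fun a b u =>
    box_eps T (box_mul T u b) * box_eps T (box_mul T a w))) => X Y c x y.
  by rewrite box_mul_linear_l linearP /GRing.scale /= mulrDl mulrA.
- by move=> u w c x y; rewrite !linearP.
- move=> u v; apply: (linear_tlift (f := fun a b w =>
    box_eps T (box_mul T u b) * box_eps T (box_mul T a w))) => X Y c x y.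
  by rewrite linearP linearP /GRing.scale /= mulrDr mulrCA.
(* The left piece of the cut is now multiplied by [w], so the test to bring forward is [x]. *)
have assoc a b c d x y : (a && (b && c)) && (d && (x && y)) =
  x && [&& a, d, b, c & y].
  by case: a; case: b; case: c; case: d; case: x.
move=> X Y Z; rewrite box_eps_mul3_bvec tlift_Delta.
under eq_bigr => p _.
  rewrite !box_eps_mul_bvec -natrM mulnb.
  rewrite assoc -mulnb natrM -[_ * _]/(_ *: _) natr_scale.
  over.
rewrite -big_mkcondr sum_hdecomp_idl /=.
by case: (boolP (horizontal_id Y)) => [/hid_left->|_] //; rewrite !andbF.
Qed.

(** * Multiplicativity of the comultiplication *)

Lemma hdecomp_vcomp X Y p q : hdecomp X p -> hdecomp Y q ->
  bot p.1 = top q.1 -> bot p.2 = top q.2 ->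
  bot X = top Y /\ hdecomp (vcomp X Y) (vcomp p.1 q.1, vcomp p.2 q.2).
Proof.
move=> /hdecompP[rp <-] /hdecompP[rq <-] b1 b2.
split; first by rewrite bot_hcomp // top_hcomp // b1 b2.
apply/hdecompP => /=; split; last by rewrite Defs.interchange.
by rewrite right_vcomp // left_vcomp // rp rq.
Qed.

(** The upper pieces are recovered from right to left: [p.2] from its top and the right edge of [X],
    then [p.1] from its top and the left edge of [p.2]. Vertical cancellation gives [q]. *)
Lemma hdecomp_vcomp_inj X Y p q p' q' :
  [&& hdecomp X p && hdecomp Y q, bot p.1 == top q.1 & bot p.2 == top q.2] ->
  [&& hdecomp X p' && hdecomp Y q', bot p'.1 == top q'.1
    & bot p'.2 == top q'.2] ->
  vcomp p.1 q.1 = vcomp p'.1 q'.1 -> vcomp p.2 q.2 = vcomp p'.2 q'.2 ->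
  (p, q) = (p', q').
Proof.
case: p q p' q' => [p1 p2] [q1 q2] [p1' p2'] [q1' q2'] /=.
case/and3P=> /andP[/hdecompP[/= rp cp] /hdecompP[/= rq cq]] /eqP b1 /eqP b2.
case/and3P=> /andP[/hdecompP[/= rp' cp'] /hdecompP[/= rq' cq']].
move=> /eqP b1' /eqP b2' c1 c2.
have e2 : p2 = p2'.
  apply: (box_tr_inj vacT); first by rewrite -(src_comp b2) c2 src_comp.
  by rewrite -(tgt_comp rp) cp -cp' tgt_comp.
have e1 : p1 = p1'.
  apply: (box_tr_inj vacT); first by rewrite -(src_comp b1) c1 src_comp.
  by rewrite rp rp' e2.
rewrite -e1 -e2 in b1' b2' c1 c2 *.
rewrite (ccomp_lcancel (vinv T) b1 b1' c1).
by rewrite (ccomp_lcancel (vinv T) b2 b2' c2).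
Qed.

Lemma hdecomp_vcomp_surj X Y r : bot X = top Y -> hdecomp (vcomp X Y) r ->
  exists p q, [/\ [&& hdecomp X p && hdecomp Y q, bot p.1 == top q.1
    & bot p.2 == top q.2], vcomp p.1 q.1 = r.1 & vcomp p.2 q.2 = r.2].
Proof.
case: r => [Z1 Z2] XY /hdecompP[/= rZ cZ].
(* By vacancy the cut of [X] is forced by the tops of [Z1] and [Z2] and by
   [right X]; the cut of [Y] is what remains of [Z1] and [Z2] below it. *)
have [p2 [tp2 rp2]] : exists p2, top p2 = top Z2 /\ right p2 = right X.
  apply: (box_tr_ex vacT); rewrite corner_tr -(tgt_comp rZ) cZ.
  by rewrite right_vcomp // src_comp // -corner_tr -corner_br XY.
have [p1 [tp1 rp1]] : exists p1, top p1 = top Z1 /\ right p1 = left p2.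
  by apply: (box_tr_ex vacT); rewrite corner_tr rZ -!corner_tl tp2.
have v1 : bot (vinv T p1) = top Z1 by rewrite tgt_inv.
have v2 : bot (vinv T p2) = top Z2 by rewrite tgt_inv.
have b1 : bot p1 = top (vcomp (vinv T p1) Z1) by rewrite src_comp // src_inv.
have b2 : bot p2 = top (vcomp (vinv T p2) Z2) by rewrite src_comp // src_inv.
have k1 : vcomp p1 (vcomp (vinv T p1) Z1) = Z1 by rewrite ccompKr.
have k2 : vcomp p2 (vcomp (vinv T p2) Z2) = Z2 by rewrite ccompKr.
have cp : hcomp p1 p2 = X.
  apply: (box_tr_inj vacT); last by rewrite tgt_comp.
  by rewrite top_hcomp // tp1 tp2 -top_hcomp // cZ src_comp.
have rq : right (vcomp (vinv T p1) Z1) = left (vcomp (vinv T p2) Z2).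
  rewrite right_vcomp // left_vcomp // rZ.
  by rewrite (right_vinv T) (left_vinv T) rp1.
exists (p1, p2), (vcomp (vinv T p1) Z1, vcomp (vinv T p2) Z2); split=> //=.
rewrite -b1 -b2 !eqxx !andbT; apply/andP; split; apply/hdecompP => //=.
(* That the lower pieces compose to [Y] is checked after putting [X] on top, where interchange
   reassembles [Z1] and [Z2]. *)
split=> //; apply: (@ccomp_lcancel _ _ _ (vinv T) X) => //.
  by rewrite -cp bot_hcomp // top_hcomp // b1 b2.
by rewrite -{1}cp Defs.interchange // k1 k2.
Qed.

Lemma box_Delta_mul u v : box_Delta T (box_mul T u v) =
  mul2 (box_bialg k T) (box_Delta T u) (box_Delta T v).
Proof.
move: u; apply: linear_bvec_ext => [c x y|c x y|X].
- by rewrite box_mul_linear_l linearP.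
- by rewrite linearP /= /mul2 linearP.
move: v; apply: linear_bvec_ext => [c x y|c x y|Y].
- by rewrite !linearP.
- by rewrite linearP /= linearP.
rewrite box_mul_bvec !box_Delta_bvec mul2_suml.
under [RHS]eq_bigr => p _.
  rewrite linear_sum; under eq_bigr => q _.
    rewrite /= /mul2 !tlift_bvec /= !box_mul_bvec.
    rewrite (_ : tens _ _ = if (bot p.1 == top q.1) && (bot p.2 == top q.2)
      then e (vcomp p.1 q.1, vcomp p.2 q.2) else 0).
    over.
    case: eqP => _ /=; last by rewrite tens0l.
    by case: eqP => _; rewrite ?linear0 ?tens_bvec.
  over.
rewrite pair_big_dep -big_mkcondr /=.
case: eqP => XY; last first.
  (* Matching cuts would make [X] and [Y] composable, so the right-hand sum is empty. *)
  rewrite linear0 big_pred0 // => -[p q]; apply/negP.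
  case/and3P=> /= /andP[Xp Yq] /eqP b1 /eqP b2.
  by case: XY; case: (hdecomp_vcomp Xp Yq b1 b2).
rewrite box_Delta_bvec.
pose f (u : (B * B) * (B * B)) := (vcomp u.1.1 u.2.1, vcomp u.1.2 u.2.2).
rewrite (@sum_bij _ _ _ (hdecomp (vcomp X Y)) (fun u => [&& hdecomp X u.1
  && hdecomp Y u.2, bot u.1.1 == top u.2.1 & bot u.1.2 == top u.2.2]) f) //.
- move=> [p q] /and3P[/= /andP[Xp Yq] /eqP b1 /eqP b2].
  by case: (hdecomp_vcomp Xp Yq b1 b2).
- move=> [p q] [p' q'] Rpq Rpq' [c1 c2].
  exact: (hdecomp_vcomp_inj Rpq Rpq' c1 c2).
- move=> [r1 r2] /(hdecomp_vcomp_surj XY)[p [q [Rpq c1 c2]]].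
  by exists (p, q); rewrite /f //= c1 c2.
Qed.

(** * The comultiplication of the unit *)

(** The right piece inherits an identity as right edge, so vacancy makes it a vertical identity; its
    left edge is then an identity, and the same argument applies to the left piece. *)
Lemma sum_hdecomp_vid (W : nmodType) (F : B * B -> W) x :
  \sum_(p | hdecomp (vid x) p) F p =
  \sum_(p : H * H | (hri p.1 == hle p.2) && (ccomp (hedge T) p.1 p.2 == x))
    F (vid p.1, vid p.2).
Proof.
apply: (@sum_bij _ _ _ _ _ (fun p => (vid p.1, vid p.2))).
- move=> [y z] /= /andP[/eqP yz /eqP <-]; apply/hdecompP => /=.
  by rewrite left_vid right_vid yz hcomp_vid.
- move=> [y z] [y' z'] _ _ /= [/(congr1 top) + /(congr1 top)].
  by rewrite !src_idn => -> ->.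
- move=> [Y Z] /hdecompP[/= YZ c].
  have ZE : Z = vid (top Z).
    apply: (right_idn_vid vacT (p := hri x)).
    by rewrite -(tgt_comp YZ) c right_vid.
  have YE : Y = vid (top Y).
    apply: (right_idn_vid vacT (p := hle (top Z))).
    by rewrite YZ {1}ZE left_vid.
  exists (top Y, top Z) => /=; last by rewrite -YE -ZE.
  by rewrite corner_tr corner_tl YZ eqxx -top_hcomp // c src_idn /=.
Qed.

Lemma box_Delta_one : box_Delta T (box_one k T) =
  \sum_(p : H * H | hri p.1 == hle p.2) e (vid p.1, vid p.2).
Proof.
(* Composable pairs of edges are grouped by their composite [x]. *)
rewrite [RHS](partition_big (fun p => ccomp (hedge T) p.1 p.2) xpredT) //=.
rewrite /box_one linear_sum; apply: eq_bigr => x _ /=.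
by rewrite box_Delta_bvec sum_hdecomp_vid.
Qed.

Lemma tlift_Delta_one (W : lmodType k) (f : kT -> kT -> W) :
  tlift f (box_Delta T (box_one k T)) =
  \sum_(p : H * H | hri p.1 == hle p.2) f (e (vid p.1)) (e (vid p.2)).
Proof.
by rewrite box_Delta_one tlift_sum; apply: eq_bigr => p _; rewrite tlift_bvec.
Qed.

Lemma box_Delta2_one : Delta2 (box_bialg k T) (box_one k T) =
  \sum_(u : H * H * H | (hri u.1.1 == hle u.1.2) && (hri u.1.2 == hle u.2))
    e (vid u.1.1, vid u.1.2, vid u.2).
Proof.
rewrite /Delta2 /= tlift_Delta_one.
under [LHS]eq_bigr => p _.
  rewrite tlift_Delta sum_hdecomp_vid.
  under eq_bigr => q _ do rewrite /tens3 !tens_bvec /=.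
  over.
rewrite pair_big_dep.
(* A triple [x, y, z] corresponds to the pair [(xy, z)] followed by the cut [(x, y)] of its first
   edge. *)
pose f (u : H * H * H) := ((ccomp (hedge T) u.1.1 u.1.2, u.2), u.1).
rewrite (@sum_bij _ _ _ _ (fun u : H * H * H =>
  (hri u.1.1 == hle u.1.2) && (hri u.1.2 == hle u.2)) f) //.
- move=> [[x y] z] /= /andP[/eqP xy /eqP yz].
  by rewrite tgt_comp // yz xy !eqxx.
- by move=> [[x y] z] [[x' y'] z'] _ _ [_ -> -> ->].
- move=> [[w z] [x y]] /= /andP[/eqP + /andP[/eqP xy /eqP c]].
  rewrite -c tgt_comp // => yz.
  by exists (x, y, z); rewrite /f /= ?xy ?yz ?c ?eqxx.
Qed.

Let algT := box_algebra k T.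

Lemma box_mul1l (u : kT) : box_mul T (box_one k T) u = u.
Proof. exact: (mul_one_l algT). Qed.

Lemma box_mul1r (u : kT) : box_mul T u (box_one k T) = u.
Proof. exact: (mul_one_r algT). Qed.

Lemma box_mul_vid x y :
  box_mul T (e (vid x)) (e (vid y)) = if x == y then e (vid y) else 0.
Proof.
rewrite box_mul_bvec tgt_idn src_idn; case: eqP => // ->.
by rewrite -{1}(src_idn (vcat T) y) comp_idl.
Qed.

(** Vertical identities are orthogonal idempotents, so the middle leg survives only where two
    composable pairs share an edge; such pairs glue to composable triples. *)
Lemma box_Delta2_one_l : Delta2 (box_bialg k T) (box_one k T) =
  mul3 (box_bialg k T)
    (\sw_(a, b <- box_Delta T (box_one k T)) tens3 a b (box_one k T))
    (\sw_(a, b <- box_Delta T (box_one k T)) tens3 (box_one k T) a b).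
Proof.
rewrite box_Delta2_one !tlift_Delta_one mul3_suml.
under [RHS]eq_bigr => p _.
  rewrite linear_sum; under eq_bigr => q _.
    rewrite /= mul3_tens // /= box_mul1l box_mul1r box_mul_vid.
    rewrite (_ : tens3 _ _ _ = if p.2 == q.1
      then e (vid p.1, vid q.1, vid q.2) else 0).
    over.
    by case: eqP => _; rewrite /tens3 ?linear0 ?tens0l ?tens_bvec.
  over.
rewrite pair_big_dep -big_mkcondr /=.
pose f (u : H * H * H) := ((u.1.1, u.1.2), (u.1.2, u.2)).
rewrite [RHS](@sum_bij _ _ _ _ (fun u : H * H * H =>
  (hri u.1.1 == hle u.1.2) && (hri u.1.2 == hle u.2)) f) //=.
- by move=> [[x y] z] /= ->; rewrite eqxx.
- by move=> [[x y] z] [[x' y'] z'] _ _ [-> -> _ ->].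
- move=> [[x y] [y' z]] /= /andP[Ryz /eqP yy']; exists (x, y, z) => /=.
    by rewrite {2}yy'.
  by rewrite /f /= {2}yy'.
Qed.

Lemma box_Delta2_one_r : Delta2 (box_bialg k T) (box_one k T) =
  mul3 (box_bialg k T)
    (\sw_(a, b <- box_Delta T (box_one k T)) tens3 (box_one k T) a b)
    (\sw_(a, b <- box_Delta T (box_one k T)) tens3 a b (box_one k T)).
Proof.
rewrite box_Delta2_one !tlift_Delta_one mul3_suml.
under [RHS]eq_bigr => p _.
  rewrite linear_sum; under eq_bigr => q _.
    rewrite /= mul3_tens // /= box_mul1l box_mul1r box_mul_vid.
    rewrite (_ : tens3 _ _ _ = if p.1 == q.2
      then e (vid q.1, vid q.2, vid p.2) else 0).
    over.
    by case: eqP => _; rewrite /tens3 ?linear0 ?tens0l ?tens_bvec.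
  over.
rewrite pair_big_dep -big_mkcondr /=.
(* The first factor now carries the last two edges of the triple. *)
pose f (u : H * H * H) := ((u.1.2, u.2), (u.1.1, u.1.2)).
rewrite [RHS](@sum_bij _ _ _ _ (fun u : H * H * H =>
  (hri u.1.1 == hle u.1.2) && (hri u.1.2 == hle u.2)) f) //=.
- by move=> [[x y] z] /= /andP[-> ->]; rewrite eqxx.
- by move=> [[x y] z] [[x' y'] z'] _ _ [_ -> -> ->].
- move=> [[y z] [x y']] /= /andP[/andP[yz xy'] /eqP yy'].
  exists (x, y, z) => /=.
    by rewrite yz yy' xy'.
  by rewrite /f /= {2}yy'.
Qed.

Lemma box_weak_bialgebra : is_weak_bialgebra (box_bialg k T).
Proof.
split=> /=.
- exact: algT.
- exact: box_coalgebra.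
- exact: box_Delta_mul.
- exact: box_Delta2_one_l.
- exact: box_Delta2_one_r.
- exact: box_eps_mul_l.
- exact: box_eps_mul_r.
Qed.

(** * The counital maps *)

Lemma eps_mul_vid x X : box_eps T (box_mul T (e (vid x)) (e X)) =
  ((x == top X) && horizontal_id X)%:R.
Proof.
rewrite box_mul_bvec tgt_idn; case: eqP => [->|_]; last by rewrite linear0.
by rewrite comp_idl box_eps_bvec.
Qed.

Lemma eps_mul_vid_r x X : box_eps T (box_mul T (e X) (e (vid x))) =
  ((x == bot X) && horizontal_id X)%:R.
Proof.
rewrite box_mul_bvec src_idn eq_sym.
case: eqP => [->|_]; last by rewrite linear0.
by rewrite comp_idr box_eps_bvec.
Qed.

Lemma box_eps_t_sum u : eps_t (box_bialg k T) u =
  \sum_(p : H * H | hri p.1 == hle p.2)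
    (box_eps T (box_mul T (e (vid p.1)) u) : k) *: e (vid p.2).
Proof.
rewrite /eps_t /= box_Delta_one mul2_suml tlift_sum; apply: eq_bigr => p _ /=.
rewrite -tens_bvec mul2_tens // tlift_tens /= => [|v|v].
- by rewrite box_mul1r.
- by move=> c x y; rewrite linearP scalerDl scalerA.
- exact: linearP.
Qed.

Lemma box_eps_s_sum u : eps_s (box_bialg k T) u =
  \sum_(p : H * H | hri p.1 == hle p.2)
    (box_eps T (box_mul T u (e (vid p.2))) : k) *: e (vid p.1).
Proof.
rewrite /eps_s /= box_Delta_one mul2_sumr tlift_sum; apply: eq_bigr => p _ /=.
rewrite -tens_bvec mul2_tens // tlift_tens /= => [|v|v].
- by rewrite box_mul1l.
- exact: linearP.
- by move=> c x y; rewrite linearP scalerDl scalerA.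
Qed.

Lemma box_eps_t_linear : linear (eps_t (box_bialg k T)).
Proof.
move=> c u v; rewrite !box_eps_t_sum scaler_sumr -big_split.
by apply: eq_bigr => p _ /=; rewrite !linearP scalerDl scalerA.
Qed.

Lemma box_eps_s_linear : linear (eps_s (box_bialg k T)).
Proof.
move=> c u v; rewrite !box_eps_s_sum scaler_sumr -big_split.
by apply: eq_bigr => p _ /=; rewrite box_mul_linear_l linearP scalerDl scalerA.
Qed.

(** The counit forces the first leg to be [top X], an identity edge; the second leg then runs over
    all edges starting at that point. For [eps_s] the second leg is [bot X] and the first runs over
    the edges ending there. *)
Lemma box_eps_t_bvec X : eps_t (box_bialg k T) (e X) =
  if horizontal_id X then lunit k T (vto (left X)) else 0.
Proof.
rewrite box_eps_t_sum.
under eq_bigr => p _ do rewrite eps_mul_vid natr_scale.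
case: ifP => hX; last by rewrite big1 // => p _; rewrite andbF.
rewrite -big_mkcondr; apply: (@sum_bij _ _ _ _ _ (fun y => (top X, y))) => /=.
- by move=> y /eqP ->; rewrite -(hid_left hX) top_hid tgt_idn src_idn !eqxx.
- by move=> y y' _ _ [].
- move=> [x y] /= /andP[/eqP xy /andP[/eqP xX _]]; exists y; last by rewrite xX.
  by rewrite -xy xX -(hid_left hX) top_hid tgt_idn src_idn.
Qed.

Lemma box_eps_s_bvec X : eps_s (box_bialg k T) (e X) =
  if horizontal_id X then runit k T (vbo (left X)) else 0.
Proof.
rewrite box_eps_s_sum.
under eq_bigr => p _ do rewrite eps_mul_vid_r natr_scale.
case: ifP => hX; last by rewrite big1 // => p _; rewrite andbF.
rewrite -big_mkcondr; apply: (@sum_bij _ _ _ _ _ (fun y => (y, bot X))) => /=.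
- by move=> y /eqP ->; rewrite -(hid_left hX) bot_hid !src_idn !eqxx.
- by move=> y y' _ _ [].
- move=> [y x] /= /andP[/eqP xy /andP[/eqP xX _]]; exists y; last by rewrite xX.
  by rewrite xy xX -(hid_left hX) bot_hid !src_idn.
Qed.

(** * The antipode *)

Lemma hdecomp_hid g p :
  hdecomp (hid g) p = (left p.1 == g) && (p.2 == hinv T p.1).
Proof.
case: p => Y Z; apply/hdecompP/andP => /= [[YZ c]|[/eqP<- /eqP->]]; last first.
  by rewrite src_inv comp_invr.
have Yg : left Y = g by rewrite -(src_comp YZ) c src_idn.
split; first by apply/eqP.
apply/eqP; apply: (@ccomp_lcancel _ _ _ (hinv T) Y); rewrite ?src_inv //.
by rewrite c comp_invr Yg.
Qed.

Lemma box_antipode_bvec X : box_antipode k T (e X) = e (box_inv T X).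
Proof. exact: linext_bvec. Qed.

HB.instance Definition _ :=
  GRing.Linear.copy (box_antipode k T) (box_antipode k T).

Lemma box_antipode_t_bvec X :
  \sw_(a, b <- box_Delta T (e X)) (box_mul T a (box_antipode k T b)) =
  if horizontal_id X then lunit k T (vto (left X)) else 0.
Proof.
rewrite tlift_Delta.
under eq_bigr => p _ do rewrite box_antipode_bvec box_mul_bvec src_inv bot_hinv.
case: horizontal_idP => [[g ->]|hX]; last first.
  (* A nonzero term makes the bottoms of the two pieces inverse to each other, so the bottom of [X]
     is an identity. *)
  apply: big1 => p /hdecompP[rp cp]; case: eqP => // bp; case: hX.
  apply/horizontal_idP/(@bot_horizontal_id (hri (bot p.2))).
  by rewrite -cp bot_hcomp // bp comp_invl.
rewrite src_idn /lunit.
(* By vacancy a cut of [hid g] is the same as an edge starting at the top of [g], namely the top of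
   its left piece. *)
rewrite (@sum_bij _ _ _ _ (hdecomp (hid g)) (fun p => top p.1)).
- apply: eq_bigr => -[Y Z]; rewrite hdecomp_hid /= => /andP[_ /eqP->].
  by rewrite bot_hinv (cinvK (hedge_inv T)) eqxx /box_inv cinvK comp_invr.
- by move=> p; rewrite hdecomp_hid corner_tl => /andP[/eqP-> _].
- move=> [Y Z] [Y' Z']; rewrite -!topredE /= !hdecomp_hid /=.
  move=> /andP[/eqP lY /eqP->] /andP[/eqP lY' /eqP->] tY.
  by rewrite (box_tl_inj vacT tY) // lY lY'.
- move=> x /eqP /(box_tl_ex vacT)[Y [tY lY]]; exists (Y, hinv T Y) => //.
  by rewrite hdecomp_hid lY !eqxx.
Qed.

Lemma box_antipode_s_bvec X :
  \sw_(a, b <- box_Delta T (e X)) (box_mul T (box_antipode k T a) b) =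
  if horizontal_id X then runit k T (vbo (left X)) else 0.
Proof.
rewrite tlift_Delta.
under eq_bigr => p _ do rewrite box_antipode_bvec box_mul_bvec tgt_inv top_hinv.
case: horizontal_idP => [[g ->]|hX]; last first.
  apply: big1 => p /hdecompP[rp cp]; case: eqP => // tp; case: hX.
  apply/horizontal_idP/(@top_horizontal_id (hle (top p.1))).
  by rewrite -cp top_hcomp // -tp comp_invr.
rewrite src_idn /runit.
(* Cuts are now indexed by the bottom of the right piece, an edge ending at the bottom of [g]. *)
rewrite (@sum_bij _ _ _ _ (hdecomp (hid g)) (fun p => bot p.2)).
- apply: eq_bigr => -[Y Z]; rewrite hdecomp_hid /= => /andP[_ /eqP->].
  by rewrite top_hinv eqxx /box_inv comp_invl.
- move=> p; rewrite hdecomp_hid corner_br => /andP[/eqP<- /eqP->].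
  by rewrite tgt_inv.
- move=> [Y Z] [Y' Z']; rewrite -!topredE /= !hdecomp_hid /=.
  move=> /andP[/eqP lY /eqP->] /andP[/eqP lY' /eqP->] bY.
  have YY' : hinv T Y = hinv T Y'.
    by apply: (box_br_inj vacT); rewrite ?tgt_inv ?lY.
  by rewrite (can_inj (cinvK (hinv T)) YY').
- move=> x /eqP /(box_br_ex vacT)[Y [bY rY]]; exists (hinv T Y, Y) => //.
  by rewrite hdecomp_hid src_inv rY (cinvK (hinv T)) !eqxx.
Qed.

Lemma box_mul_lunit X p : box_mul T (e X) (lunit k T p) =
  if hle (bot X) == p then e X else 0.
Proof.
rewrite /lunit linear_sum /=.
under eq_bigr => x _ do rewrite box_mul_bvec src_idn.
rewrite -big_mkcondr; case: eqP => [<-|Xp].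
  rewrite (big_pred1 (bot X)) ?comp_idr // => x /=.
  by rewrite [bot X == x]eq_sym; case: (x =P bot X) => [->|];
     rewrite ?eqxx ?andbF.
apply: big_pred0 => x; apply/negP => /andP[/eqP xp /eqP bX].
by case: Xp; rewrite bX.
Qed.

Lemma box_mul_runit X p : box_mul T (runit k T p) (e X) =
  if hri (top X) == p then e X else 0.
Proof.
rewrite /runit box_mul_suml.
under eq_bigr => x _ do rewrite box_mul_bvec tgt_idn.
rewrite -big_mkcondr; case: eqP => [<-|Xp].
  rewrite (big_pred1 (top X)) ?comp_idl // => x /=.
  by case: (x =P top X) => [->|]; rewrite ?eqxx ?andbF.
apply: big_pred0 => x; apply/negP => /andP[/eqP xp /eqP xX].
by case: Xp; rewrite -xX.
Qed.

(** Bracketed to the right, the last two factors sum to [eps_t] of the right piece, so only the cut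
    [(X, hid (right X))] counts. The remaining [lunit] fixes the inverse of [X], whose bottom left
    corner is the top right corner of [X]. *)
Lemma box_antipode_id_bvec X :
  \sw_(a, b, c <- Delta2 (box_bialg k T) (e X))
    box_mul T (box_mul T (box_antipode k T a) b) (box_antipode k T c) =
  box_antipode k T (e X).
Proof.
rewrite box_Delta2_bvec (sum_hdecompA T (fun x y z => e (x, y, z))).
transitivity (\sum_(p | hdecomp X p) box_mul T (box_antipode k T (e p.1))
  (\sw_(a, b <- box_Delta T (e p.2)) (box_mul T a (box_antipode k T b)))).
  rewrite /tlift3 linear_sum; apply: eq_bigr => p _.
  rewrite tlift_Delta !linear_sum; apply: eq_bigr => q _ /=.
  by rewrite [LHS]linext_bvec; exact/esym/(mul_assoc (box_algebra k T)).
under eq_bigr => p _ do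
  rewrite box_antipode_t_bvec (fun_if (box_mul T _)) linear0.
rewrite -big_mkcondr sum_hdecomp_idr /= box_antipode_bvec box_mul_lunit.
by rewrite tgt_inv src_idn corner_tl src_inv eqxx.
Qed.

Lemma box_is_antipode : is_antipode (box_bialg k T) (box_antipode k T).
Proof.
split=> /=.
- exact: linearP.
- apply: linear_bvec_ext => [c u v||X]; first by rewrite !linearP.
  + exact: box_eps_t_linear.
  + by rewrite box_antipode_t_bvec box_eps_t_bvec.
- apply: linear_bvec_ext => [c u v||X]; first by rewrite !linearP.
  + exact: box_eps_s_linear.
  + by rewrite box_antipode_s_bvec box_eps_s_bvec.
- apply: linear_bvec_ext => [c u v||X].
  + by rewrite Delta2_linear linearP.
  + exact: linearP.
  + exact: box_antipode_id_bvec.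
Qed.

(** * Images of the counital maps as generated subalgebras *)

(* Both counital maps have this shape, with [c] the partition of the unit into
   the idempotents [lunit p], resp. [runit p]. *)
Lemma image_generated (f : kT -> kT) (c : P -> kT) (pt : V -> P) :
  linear f ->
  (forall X, f (e X) = if horizontal_id X then c (pt (left X)) else 0) ->
  (forall p, pt (idn (vedge T) p) = p) ->
  (forall p q, box_mul T (c p) (c q) = if p == q then c q else 0) ->
  \sum_p c p = box_one k T ->
  forall u, (exists h, u = f h) <->
    in_generated_subalgebra (box_bialg k T) (fun v => exists p, v = c p) u.
Proof.
move=> fl fE ptE cM c1 u; have fc p : c p = f (e (hid (idn (vedge T) p))).
  rewrite fE src_idn ptE ifT //; by apply/horizontal_idP; eexists.
have f0 : f 0 = 0 by rewrite linear_expand // linear0.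
(* For one inclusion the image of [f] is shown to be a subalgebra; for the other, its elements are
   linear combinations of the [c p]. *)
split=> [[h ->] A subA cA | /(_ (fun x => exists h, x = f h))]; last first.
  apply=> [|v [p ->]]; last by exists (e (hid (idn (vedge T) p))).
  have im_add x y : (exists h, x = f h) -> (exists h, y = f h) ->
      exists h, x + y = f h.
    (* [linear] speaks of [a *: u + v], hence the scalar [1] here and the summand [0] for scaling
       below. *)
    by move=> [h ->] [h' ->]; exists (1 *: h + h'); rewrite fl scale1r.
  have im_sum (J : finType) (F : J -> kT) :
      (forall j, exists h, F j = f h) -> exists h, \sum_j F j = f h.
    by move=> imF; elim/big_ind: _ => //; exists 0.
  have im_scale a x : (exists h, x = f h) -> exists h, a *: x = f h.
    by move=> [h ->]; exists (a *: h + 0); rewrite fl f0 addr0.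
  split=> //=.
  - by rewrite -c1; apply: im_sum => p; rewrite fc; eexists.
  - move=> x y [h ->] [h' ->].
    rewrite (linear_expand fl h) (linear_expand fl h') /linext box_mul_suml.
    apply: (im_sum) => X; rewrite linear_sum; apply: im_sum => Y /=.
    rewrite linearZ /=; apply: (im_scale).
    (* Adding [0] gives the left factor the shape in which its scalar can be pulled out. *)
    rewrite -[_ *: f (e X)]addr0 box_mul_linear_l box_mul0l addr0.
    apply: im_scale; rewrite !fE.
    case: ifP => _; last by rewrite box_mul0l; exists 0.
    case: ifP => _; last by rewrite linear0; exists 0.
    rewrite cM; case: ifP => _; last by exists 0.
    by rewrite fc; eexists.
have A0 : A 0.
  rewrite -(scale0r (hone (box_bialg k T))).
  by apply: (sub_scale subA); exact: (sub_one subA).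
rewrite (linear_expand fl); apply: (big_ind A) => //.
  exact: (sub_add subA).
move=> X _; apply: (sub_scale subA); rewrite fE.
by case: ifP => // _; apply: cA; eexists.
Qed.

(** Every edge in the first factor starts at [p], and right multiplication by [lunit k T q] keeps
    exactly the boxes whose bottom starts at [q]. *)
Lemma lunit_mul p q :
  box_mul T (lunit k T p) (lunit k T q) = if p == q then lunit k T q else 0.
Proof.
rewrite {1}/lunit box_mul_suml.
under eq_bigr => x /eqP xp do rewrite box_mul_lunit tgt_idn xp.
by case: (p =P q) => [->|_] //; rewrite big1.
Qed.

Lemma runit_mul p q :
  box_mul T (runit k T p) (runit k T q) = if p == q then runit k T q else 0.
Proof.
rewrite {2}/runit linear_sum /=.
under eq_bigr => x /eqP xq do rewrite box_mul_runit src_idn xq.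
by rewrite [p == q]eq_sym; case: (q =P p) => [->|_] //; rewrite big1.
Qed.

Lemma sum_lunit : \sum_p lunit k T p = box_one k T.
Proof. by rewrite /box_one (partition_big hle xpredT). Qed.

Lemma sum_runit : \sum_p runit k T p = box_one k T.
Proof. by rewrite /box_one (partition_big hri xpredT). Qed.

End BoxWeakHopf.

Theorem theorem3p1 (k : fieldType) (B H V P : finType)
    (T : double_groupoid B H V P) (hT : vacant T) :
  is_weak_hopf_algebra (box_bialg k T) (box_antipode k T) /\
  (forall u : fspace k B,
     in_source_subalgebra (box_bialg k T) u <->
     in_generated_subalgebra (box_bialg k T)
       (fun v => exists p : P, v = runit k T p) u) /\
  (forall u : fspace k B,
     in_target_subalgebra (box_bialg k T) u <->
     in_generated_subalgebra (box_bialg k T)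
       (fun v => exists p : P, v = lunit k T p) u).
Proof.
split; first by split; [exact: box_weak_bialgebra | exact: box_is_antipode].
split=> u.
(* Here [pt] is the bottom of a vertical edge; for the target subalgebra it is the top. *)
- apply: image_generated.
  + exact: box_eps_s_linear.
  + exact: box_eps_s_bvec.
  + exact: tgt_idn.
  + exact: runit_mul.
  + exact: sum_runit.
- apply: image_generated.
  + exact: box_eps_t_linear.
  + exact: box_eps_t_bvec.
  + exact: src_idn.
  + exact: lunit_mul.
  + exact: sum_lunit.
Qed.
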